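(* Let $A$ be an $\ell_\infty$-embeddable abelian $C^*$-algebra. Then its multiplier algebra $M(A)$ is $\ell_\infty$-embeddable. Moreover, $M(A)$ is universally $(\ell_\infty\setminus c_0)$-embeddable if and only if $A$ is universally $(\ell_\infty\setminus c_0)$-embeddable.
   Context: $\ell_\infty$ is the $C^*$-algebra of bounded complex sequences and $c_0$ its ideal of null sequences. For a commutative $C^*$-algebra $A$, $M(A)=\{T\in B(A): T(ab)=aT(b)\ \text{for all } a,b\in A\}$, where $B(A)$ is the algebra of bounded linear operators on $A$; it is an abelian $C^*$-algebra (with $M(A)=A$ if $A$ is unital, and $M(C_0(L))\cong C_b(L)$ for $L$ locally compact Hausdorff). For a $C^*$-algebra $A$, an $\ell_\infty$-embedding of $A$ is an injective $^*$-homomorphism $\phi\colon A\to\ell_\infty$; $A$ is $\ell_\infty$-embeddable if one exists. $A$ is universally $(\ell_\infty\setminus c_0)$-embeddable if there is an $\ell_\infty$-embedding $\phi$ of $A$ with $\phi(A)\cap c_0=\{0\}$ and every $\ell_\infty$-embedding $\phi$ of $A$ satisfies $\phi(A)\cap c_0=\{0\}$. *)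

(* Defs.v *)
From HB Require Import structures.
From mathcomp Require Import all_boot all_order all_algebra.
From mathcomp Require Import complex.
From mathcomp Require Import all_classical all_reals.
From mathcomp Require Import topology normedtype sequences.

Set Implicit Arguments.
Unset Strict Implicit.
Unset Printing Implicit Defensive.

Import Order.TTheory GRing.Theory Num.Theory.
Import numFieldNormedType.Exports.

Local Open Scope classical_set_scope.
Local Open Scope ring_scope.

Declare Scope cstar_scope.
Delimit Scope cstar_scope with cstar.
Local Open Scope cstar_scope.

Reserved Notation "a '*c' b" (at level 40, left associativity).
Reserved Notation "a ^star" (at level 2, format "a ^star").

(* MathComp rings are unital, hence the separate product below.
   C*-algebras are complex, need not have a unit, and may be zero. The norm of
   a module over [R[i]] is [R[i]]-valued, its values being nonnegative reals. *)
HB.mixin Record CompleteNormedModule_isCStarAlgebra (R : realType) A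
    & CompleteNormedModule R[i] A := {
  cmul : A -> A -> A;
  cstar : A -> A;
  cmulA : associative cmul;
  cmulDl : left_distributive cmul +%R;
  cmulDr : right_distributive cmul +%R;
  cscaleAl : forall (k : R[i]) (a b : A), k *: cmul a b = cmul (k *: a) b;
  cscaleAr : forall (k : R[i]) (a b : A), k *: cmul a b = cmul a (k *: b);
  cstarK : involutive cstar;
  cstarD : {morph cstar : a b / a + b >-> a + b};
  cstarZ : forall (k : R[i]) (a : A), cstar (k *: a) = k^* *: cstar a;
  cstarM : forall a b : A, cstar (cmul a b) = cmul (cstar b) (cstar a);
  cnorm_mul_le : forall a b : A, `|cmul a b| <= `|a| * `|b|;
  cnorm_cstar_mul : forall a : A, `|cmul (cstar a) a| = `|a| ^+ 2
}.

#[short(type="cstarAlgType")]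
HB.structure Definition CStarAlgebra (R : realType) :=
  {A of CompleteNormedModule_isCStarAlgebra R A & CompleteNormedModule R[i] A}.

Notation "a *c b" := (cmul a b) : cstar_scope.
Notation "a ^star" := (cstar a) : cstar_scope.

HB.mixin Record CStarAlgebra_isAbelian (R : realType) A & CStarAlgebra R A := {
  cmulC : commutative (cmul : A -> A -> A)
}.

#[short(type="abelianCstarAlgType")]
HB.structure Definition AbelianCStarAlgebra (R : realType) :=
  {A of CStarAlgebra_isAbelian R A & CStarAlgebra R A}.

Section cstar_theory.
Variables (R : realType) (A : cstarAlgType R).
Implicit Types a b c : A.

Lemma cmulNl a b : (- a) *c b = - (a *c b).
Proof. by rewrite -scaleN1r -cscaleAl scaleN1r. Qed.

Lemma cmulNr a b : a *c (- b) = - (a *c b).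
Proof. by rewrite -scaleN1r -cscaleAr scaleN1r. Qed.

Lemma cmulBl a b c : (a - b) *c c = a *c c - b *c c.
Proof. by rewrite cmulDl cmulNl. Qed.

Lemma cmulBr a b c : a *c (b - c) = a *c b - a *c c.
Proof. by rewrite cmulDr cmulNr. Qed.

Lemma cmul_eq0 a : (forall b, b *c a = 0) -> a = 0.
Proof.
move=> /(_ a^star) a0; apply/eqP; rewrite -normr_eq0.
suff : `|a| ^+ 2 == 0 by rewrite expf_eq0.
by rewrite -cnorm_cstar_mul a0 normr0.
Qed.

Lemma cmulI a b : (forall c, c *c a = c *c b) -> a = b.
Proof.
move=> ab; apply/eqP; rewrite -subr_eq0; apply/eqP/cmul_eq0 => c.
by rewrite cmulBr ab subrr.
Qed.

Lemma cnorm_star_le a : `|a| <= `|a^star|.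
Proof.
have [->|a0] := eqVneq a 0; first by rewrite normr0.
rewrite -(@ler_pM2r _ `|a|) ?normr_gt0// -expr2 -cnorm_cstar_mul.
exact: cnorm_mul_le.
Qed.

Lemma cnorm_star a : `|a^star| = `|a|.
Proof.
apply/eqP; rewrite eq_le cnorm_star_le andbT.
by have := cnorm_star_le a^star; rewrite cstarK.
Qed.

End cstar_theory.

Section sup_norm.
Context {R : realType} {X : Type} {V : normedModType R[i]}.
Implicit Types (D : set X) (f g : X -> V).

Definition bounded_on D f := exists M : R, forall x, D x -> `|f x| <= M%:C%C.

(* The supremum is taken in [R], where the values of the norm live; it is
   meaningful only for [f] bounded on [D]. *)
Definition sup_norm D f : R[i] :=
  (sup [set complex.Re `|f x| | x in D])%:C%C.

Lemma Re_normE (v : V) : (complex.Re `|v|)%:C%C = `|v|.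
Proof. by rewrite RRe_real ?normr_real. Qed.

Lemma sup_norm_ub D f x : bounded_on D f -> D x -> `|f x| <= sup_norm D f.
Proof.
move=> [M fM] Dx; rewrite -Re_normE lecR; apply: ub_le_sup; last by exists x.
by exists M => _ [y Dy <-]; rewrite -lecR Re_normE fM.
Qed.

Lemma sup_norm_le D f (M : R[i]) : D !=set0 ->
  (forall x, D x -> `|f x| <= M) -> sup_norm D f <= M.
Proof.
move=> [x Dx] fM.
have /RRe_real ME : M \is Num.real.
  by apply: ger0_real; rewrite (le_trans _ (fM _ Dx)).
rewrite -ME lecR; apply: ge_sup; first by exists (complex.Re `|f x|), x.
by move=> _ [y Dy <-]; rewrite -lecR Re_normE ME fM.
Qed.

Lemma sup_normD D f g : D !=set0 -> bounded_on D f -> bounded_on D g ->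
  sup_norm D (f \+ g) <= sup_norm D f + sup_norm D g.
Proof.
move=> D0 bf bg; apply: sup_norm_le => // x Dx.
by rewrite (le_trans (ler_normD _ _))// lerD// sup_norm_ub.
Qed.

Lemma bounded_onZ D (k : R[i]) f : bounded_on D f -> bounded_on D (k \*: f).
Proof.
move=> [M fM]; exists (complex.Re `|k| * M) => x Dx.
rewrite /= normrZ -[X in X * _ <= _](RRe_real (normr_real k)) rmorphM.
by apply: ler_wpM2l; rewrite ?fM// RRe_real ?normr_real.
Qed.

Lemma sup_normZ D (k : R[i]) f : D !=set0 -> bounded_on D f ->
  sup_norm D (k \*: f) = `|k| * sup_norm D f.
Proof.
move=> D0 bf; apply/eqP; rewrite eq_le; apply/andP; split.
  by apply: sup_norm_le => // x Dx; rewrite /= normrZ ler_wpM2l// sup_norm_ub.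
have [->|k0] := eqVneq k 0.
  rewrite normr0 mul0r; case: D0 => x Dx.
  apply: le_trans (sup_norm_ub (bounded_onZ 0 bf) Dx) => //.
rewrite -ler_pdivlMl ?normr_gt0//; apply: sup_norm_le => // x Dx.
rewrite ler_pdivlMl ?normr_gt0// -normrZ.
exact: (sup_norm_ub (bounded_onZ k bf) Dx).
Qed.

Lemma norm_cvg_le (T : Type) (F : set_system T) (FF : ProperFilter F)
    (h : T -> V) (l : V) (M : R[i]) :
  h t @[t --> F] --> l -> (\forall t \near F, `|h t| <= M) -> `|l| <= M.
Proof.
move=> hl hM.
have Mr : M \is Num.real.
  by have [t ht] := filter_ex hM; apply: ger0_real; rewrite (le_trans _ ht).
rewrite real_leNgt//; apply/negP => Ml.
have : 0 < `|l| - M by rewrite subr_gt0.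
move: hl => /cvgrPdist_lt /[apply] hl'.
have [t [ht1 ht2]] := filter_ex (filterI hl' hM).
have : `|l| < `|l| - M + M.
  rewrite -[X in `|X| < _](subrK (h t)) (le_lt_trans (ler_normD _ _))//.
  exact: ltr_leD.
by rewrite subrK ltxx.
Qed.

End sup_norm.

Section pointwise_limits.
Context {R : realType} {X : Type} {V S : normedModType R[i]}.
Variables (D : set X) (ev : S -> X -> V).
Hypothesis evB : forall f g x, ev (f - g) x = ev f x - ev g x.

Lemma cauchy_ev (F : set_system S) (FF : ProperFilter F) (c : R[i]) x :
  0 <= c -> (forall f, `|ev f x| <= c * `|f|) -> cauchy F ->
  cauchy (ev f x @[f --> F]).
Proof.
move=> c0 evc /cauchy_ballP cF; apply/cauchy_ballP => e e0.
have c1 : 0 < c + 1 by rewrite ltr_wpDl.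
rewrite near_map2; have [PQ FPQ sPQ] := cF _ (divr_gt0 e0 c1).
exists PQ => // -[f g] /sPQ; rewrite /= -!ball_normE/= => fg.
rewrite -evB (le_lt_trans (evc _))//.
rewrite ltr_pdivlMr// in fg; apply: le_lt_trans fg.
by rewrite mulrC ler_wpM2l// lerDl.
Qed.

Lemma cvg_ev (F : set_system S) (FF : ProperFilter F) (g : S) :
  (forall f (M : R[i]), 0 <= M -> (forall x, D x -> `|ev f x| <= M) ->
    `|f| <= M) ->
  (forall f x, D x -> `|ev f x| <= `|f|) -> cauchy F ->
  (forall x, D x -> ev f x @[f --> F] --> ev g x) -> F --> g.
Proof.
move=> normle le_norm /cauchy_ballP cF evg; apply/cvgrPdist_le => e e0.
have e20 : 0 < e / 2 by rewrite divr_gt0.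
have := cF _ e20; near_simpl => /nearP_dep cF'.
near=> f; apply: normle; first exact: ltW.
move=> x Dx; rewrite evB.
have fF : \forall f' \near F, ball f (e / 2) f' by near: f.
have /cvgrPdist_le/(_ _ e20) gF := evg x Dx.
have [f' [ff' gf']] := filter_ex (filterI fF gF).
rewrite -[ev g x](subrK (ev f' x)) -addrA (le_trans (ler_normD _ _))//.
rewrite [leRHS](splitr e) lerD// -evB (le_trans (le_norm _ _ Dx))//.
by move: ff'; rewrite -ball_normE/= distrC => /ltW.
Unshelve. all: by end_near. Qed.

End pointwise_limits.

Section complex_complete.
Variable R : realType.

Lemma normc_ge_Im (z : R[i]) : `|complex.Im z|%:C%C <= `|z|.
Proof.
rewrite normc_def lecR -sqrtr_sqr ler_wsqrtr// lerDr sqr_ge0//.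
Qed.

Lemma normc_le_ReIm (z : R[i]) :
  `|z| <= (`|complex.Re z| + `|complex.Im z|)%:C%C.
Proof.
rewrite normc_def lecR -[leRHS]ger0_norm ?addr_ge0// -sqrtr_sqr ler_wsqrtr//.
rewrite sqrrD !real_normK ?num_real// -addrA lerD2l lerDr.
by rewrite mulrn_wge0// mulr_ge0.
Qed.

Lemma complex_complete (F : set_system R[i]^o) :
  ProperFilter F -> cauchy F -> cvg F.
Proof.
move=> FF /cauchy_ballP cF.
have cvg_part (p : R[i] -> R) : (forall x y, p (x - y) = p x - p y) ->
    (forall z, `|p z|%:C%C <= `|z|) -> cvg (p z @[z --> F]).
  move=> pB ple; apply/cauchy_cvgP/cauchy_ballP => e e0.
  have e0' : 0 < e%:C%C by rewrite ltcR.
  rewrite near_map2; have [PQ FPQ sPQ] := cF _ e0'.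
  exists PQ => // -[z t] /sPQ; rewrite /= -!ball_normE/= => zt.
  by rewrite -ltcR -pB (le_lt_trans (ple _)).
have /cvg_ex[/= a /cvgrPdist_lt aF] :
    cvg (complex.Re z @[z --> F]).
  by apply: cvg_part => [[? ?] [? ?]//|z]; exact: normc_ge_Re.
have /cvg_ex[/= b /cvgrPdist_lt bF] :
    cvg (complex.Im z @[z --> F]).
  by apply: cvg_part => [[? ?] [? ?]//|z]; exact: normc_ge_Im.
apply/cvg_ex; exists (a +i* b)%C; apply/cvgrPdist_lt => /= e e0.
have er : (complex.Re e)%:C%C = e by rewrite RRe_real ?gtr0_real.
have e20 : 0 < complex.Re e / 2 by rewrite divr_gt0// -ltcR er.
apply: filterS2 (aF _ e20) (bF _ e20) => -[x y]/= ax bxy.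
rewrite (le_lt_trans (normc_le_ReIm _))// -er ltcR [ltRHS]splitr.
exact: ltrD.
Qed.

End complex_complete.

Section ell_infty.
Variable R : realType.

Definition ell_infty_pred : {pred nat -> R[i]^o} :=
  fun u => `[< bounded_fun u >].

Record ell_infty := EllInfty {
  ell_infty_seq :> nat -> R[i]^o;
  ell_infty_seqP : ell_infty_pred ell_infty_seq
}.

HB.instance Definition _ := [isSub for ell_infty_seq].
HB.instance Definition _ := [Choice of ell_infty by <:].

Lemma bounded_funE (u : nat -> R[i]^o) :
  bounded_fun u <-> bounded_on setT u.
Proof.
split=> [[M [Mr Mu]]|[M uM]].
  exists (complex.Re M + 1) => n _; rewrite rmorphD/= RRe_real//.
  by apply: Mu => //; rewrite ltrDl.
exists M%:C%C; split; first exact/complex_realP/ex_intro.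
by move=> x Mx n _; apply: le_trans (uM n I) (ltW Mx).
Qed.

Lemma ell_inftyP (u : ell_infty) : bounded_on setT u.
Proof. by apply/bounded_funE; exact/asboolP/ell_infty_seqP. Qed.

Lemma ell_infty_submod_closed : submod_closed ell_infty_pred.
Proof.
split=> [|k u v /asboolP/bounded_funE bu /asboolP/bounded_funE [N vN]].
  by apply/asboolP/bounded_funE; exists 0 => n _; rewrite normr0.
have [M uM] := bounded_onZ k bu; apply/asboolP/bounded_funE.
exists (M + N) => n _; rewrite (le_trans (ler_normD _ _))// rmorphD lerD//.
  exact: uM.
exact: vN.
Qed.

HB.instance Definition _ := GRing.isSubmodClosed.Build _ _ ell_infty_pred
  ell_infty_submod_closed.
HB.instance Definition _ := [SubChoice_isSubLmodule of ell_infty by <:].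

Definition ell_infty_norm (u : ell_infty) : R[i] := sup_norm setT u.

Let setT0 : [set: nat] !=set0. Proof. by exists 0%N. Qed.

Let norm_ler_normD (u v : ell_infty) :
  ell_infty_norm (u + v) <= ell_infty_norm u + ell_infty_norm v.
Proof. exact: sup_normD (ell_inftyP u) (ell_inftyP v). Qed.

Let norm_normrZ (k : R[i]) (u : ell_infty) :
  ell_infty_norm (k *: u) = `|k| * ell_infty_norm u.
Proof. exact: sup_normZ (ell_inftyP u). Qed.

Let norm_eq0 (u : ell_infty) : ell_infty_norm u = 0 -> u = 0.
Proof.
move=> u0; apply/val_inj/funext => n /=; apply/eqP.
by rewrite -normr_le0 -u0; apply: sup_norm_ub => //; exact: ell_inftyP.
Qed.

HB.instance Definition _ := Lmodule_isNormed.Build R[i] ell_infty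
  norm_ler_normD norm_normrZ norm_eq0.

Lemma ell_infty_norm_ub (u : ell_infty) n : `|u n| <= `|u|.
Proof. by apply: sup_norm_ub => //; exact: ell_inftyP. Qed.

Lemma ell_infty_norm_le (u : ell_infty) (M : R[i]) :
  (forall n, `|u n| <= M) -> `|u| <= M.
Proof. by move=> uM; apply: sup_norm_le. Qed.

Lemma ell_infty_complete (F : set_system ell_infty) :
  ProperFilter F -> cauchy F -> cvg F.
Proof.
move=> FF cF.
have evB (u v : ell_infty) n : (u - v) n = u n - v n by [].
have cv n : cvg ((u : ell_infty) n @[u --> F]).
  apply: complex_complete; apply: (cauchy_ev evB FF ler01) cF => u.
  by rewrite mul1r ell_infty_norm_ub.
pose l n : R[i]^o := lim ((u : ell_infty) n @[u --> F]).
have [v vF] : exists v : ell_infty, \forall u \near F, `|v - u| < 1.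
  have /cauchy_ballP/(_ _ ltr01)/nearP_dep/filter_ex[v vF] := cF.
  by exists v; apply: filterS vF => u; rewrite -ball_normE.
have vE : (complex.Re `|v| + 1)%:C%C = `|v| + 1.
  by rewrite -[in RHS]Re_normE; exact: rmorphD.
have lP : ell_infty_pred l.
  apply/asboolP/bounded_funE; exists (complex.Re `|v| + 1) => n _.
  rewrite vE; apply: norm_cvg_le (cv n) _.
  apply: filterS vF => u /ltW vu; rewrite -[u n](subKr (v n)).
  rewrite (le_trans (ler_normB _ _))// lerD ?ell_infty_norm_ub//.
  exact: le_trans (ell_infty_norm_ub (v - u) n) vu.
apply/cvg_ex; exists (EllInfty lP); apply: (cvg_ev (D := setT) evB) => //.
- by move=> u M _ uM; apply: ell_infty_norm_le => n; exact: uM.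
- by move=> u n _; exact: ell_infty_norm_ub.
Qed.

HB.instance Definition _ := Uniform_isComplete.Build ell_infty
  ell_infty_complete.

Let mul_subproof (u v : ell_infty) :
  ell_infty_pred (fun n => (u n * v n : R[i])).
Proof.
have [[M uM] [N vN]] := (ell_inftyP u, ell_inftyP v).
apply/asboolP/bounded_funE; exists (M * N) => n _.
by rewrite normrM rmorphM ler_pM//; [exact: uM|exact: vN].
Qed.

Definition ell_infty_mul (u v : ell_infty) : ell_infty :=
  EllInfty (mul_subproof u v).

Let star_subproof (u : ell_infty) :
  ell_infty_pred (fun n => (u n : R[i])^*).
Proof.
have [M uM] := ell_inftyP u; apply/asboolP/bounded_funE; exists M => n _.
by rewrite norm_conjC; exact: uM.
Qed.

Definition ell_infty_star (u : ell_infty) : ell_infty :=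
  EllInfty (star_subproof u).

Let mulA : associative ell_infty_mul.
Proof. by move=> u v w; apply/val_inj/funext => n; exact: mulrA. Qed.
Let mulDl : left_distributive ell_infty_mul +%R.
Proof. by move=> u v w; apply/val_inj/funext => n; exact: mulrDl. Qed.
Let mulDr : right_distributive ell_infty_mul +%R.
Proof. by move=> u v w; apply/val_inj/funext => n; exact: mulrDr. Qed.
Let scaleAl (k : R[i]) (u v : ell_infty) :
  k *: ell_infty_mul u v = ell_infty_mul (k *: u) v.
Proof. by apply/val_inj/funext => n; exact: mulrA. Qed.
Let scaleAr (k : R[i]) (u v : ell_infty) :
  k *: ell_infty_mul u v = ell_infty_mul u (k *: v).
Proof. by apply/val_inj/funext => n; exact: mulrCA. Qed.
Let starK : involutive ell_infty_star.
Proof. by move=> u; apply/val_inj/funext => n; exact: conjCK. Qed.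
Let starD : {morph ell_infty_star : u v / u + v >-> u + v}.
Proof. by move=> u v; apply/val_inj/funext => n; exact: rmorphD. Qed.
Let starZ (k : R[i]) (u : ell_infty) :
  ell_infty_star (k *: u) = k^* *: ell_infty_star u.
Proof. by apply/val_inj/funext => n; exact: rmorphM. Qed.
Let mulC : commutative ell_infty_mul.
Proof. by move=> u v; apply/val_inj/funext => n; exact: mulrC. Qed.
Let starM (u v : ell_infty) : ell_infty_star (ell_infty_mul u v) =
  ell_infty_mul (ell_infty_star v) (ell_infty_star u).
Proof. by rewrite mulC; apply/val_inj/funext => n; exact: rmorphM. Qed.
Let norm_mul_le (u v : ell_infty) : `|ell_infty_mul u v| <= `|u| * `|v|.
Proof.
apply: ell_infty_norm_le => n.
by rewrite normrM ler_pM// ell_infty_norm_ub.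
Qed.
Let norm_star_mul (u : ell_infty) :
  `|ell_infty_mul (ell_infty_star u) u| = `|u| ^+ 2.
Proof.
have star_le : `|ell_infty_star u| <= `|u|.
  by apply: ell_infty_norm_le => n; rewrite norm_conjC ell_infty_norm_ub.
apply/eqP; rewrite eq_le; apply/andP; split.
  by rewrite (le_trans (norm_mul_le _ _))// expr2 ler_wpM2r.
set N := `|_|; have N0 : 0 <= N by exact: normr_ge0.
rewrite -[leRHS]sqrtCK ler_sqr ?nnegrE ?sqrtC_ge0//.
apply: ell_infty_norm_le => n; rewrite -ler_sqr ?nnegrE ?sqrtC_ge0// sqrtCK.
apply: le_trans (ell_infty_norm_ub (ell_infty_mul (ell_infty_star u) u) n).
by rewrite /= normrM norm_conjC expr2.
Qed.

HB.instance Definition _ := CompleteNormedModule_isCStarAlgebra.Build R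
  ell_infty mulA mulDl mulDr scaleAl scaleAr starK starD starZ starM
  norm_mul_le norm_star_mul.
HB.instance Definition _ := CStarAlgebra_isAbelian.Build R ell_infty mulC.

Definition c0 : set ell_infty :=
  [set u | u n @[n --> \oo] --> (0 : R[i]^o)].

End ell_infty.
Arguments c0 R : clear implicits.

Section multiplier.
Variables (R : realType) (A : abelianCstarAlgType R).
Implicit Types a b c : A.

Definition is_bounded_operator (T : A -> A) :=
  linear T /\ exists M : R, forall a, `|T a| <= M%:C%C * `|a|.

Definition is_multiplier (T : A -> A) :=
  is_bounded_operator T /\ forall a b, T (a *c b) = a *c T b.

Definition multiplier_pred : {pred A -> A} := fun T => `[< is_multiplier T >].

Record multiplier := Multiplier {
  multiplier_fun :> A -> A;
  multiplier_funP : multiplier_pred multiplier_fun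
}.

HB.instance Definition _ := [isSub for multiplier_fun].
HB.instance Definition _ := [Choice of multiplier by <:].

Lemma multiplierP (T : multiplier) : is_multiplier T.
Proof. exact/asboolP/multiplier_funP. Qed.

Lemma multiplier_linear (T : multiplier) : linear T.
Proof. by have [[]] := multiplierP T. Qed.

Lemma multiplierD (T : multiplier) a b : T (a + b) = T a + T b.
Proof. by rewrite -[a]scale1r multiplier_linear !scale1r. Qed.

Lemma multiplier0 (T : multiplier) : T 0 = 0.
Proof. by apply: (addrI (T 0)); rewrite -multiplierD !addr0. Qed.

Lemma multiplierZ (T : multiplier) (k : R[i]) a : T (k *: a) = k *: T a.
Proof. by rewrite -[k *: a]addr0 multiplier_linear multiplier0 addr0. Qed.

Lemma multiplierM (T : multiplier) a b : T (a *c b) = a *c T b.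
Proof. by have [_] := multiplierP T. Qed.

Lemma multiplier_submod_closed : submod_closed multiplier_pred.
Proof.
split.
  apply/asboolP; split; first split.
  - by move=> k a b; rewrite scaler0 addr0.
  - by exists 0 => a; rewrite mul0r normr0.
  - move=> a b; rewrite (_ : (0 : A -> A) b = 0)//.
    by rewrite -(scale0r b) -cscaleAr !scale0r.
move=> k S T /asboolP[[Sl [M SM]] SA] /asboolP[[Tl [N TN]] TA].
apply/asboolP; split; first split.
- move=> h a b /=.
  rewrite !fctE Sl Tl !scalerDr addrACA !scalerA mulrC //.
- exists (complex.Re `|k| * M + N) => a.
  rewrite !fctE (le_trans (ler_normD _ _))// rmorphD/= mulrDl lerD//.
  rewrite normrZ rmorphM -mulrA -[X in X * _ <= _](RRe_real (normr_real k)).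
  by apply: ler_wpM2l; rewrite ?SM// RRe_real ?normr_real.
- by move=> a b; rewrite !fctE SA TA cmulDr cscaleAr.
Qed.

HB.instance Definition _ := GRing.isSubmodClosed.Build _ _ multiplier_pred
  multiplier_submod_closed.
HB.instance Definition _ := [SubChoice_isSubLmodule of multiplier by <:].

Definition unit_ball : set A := [set a | `|a| <= 1].

Definition multiplier_norm (T : multiplier) : R[i] := sup_norm unit_ball T.

Let unit_ball0 : unit_ball !=set0.
Proof. by exists 0; rewrite /unit_ball/= normr0. Qed.

Lemma multiplier_bounded_on (T : multiplier) : bounded_on unit_ball T.
Proof.
have [[_ [M TM]] _] := multiplierP T; exists `|M| => a a1.
have [->|a0] := eqVneq a 0; first by rewrite multiplier0 normr0 ler0c.
rewrite (le_trans (TM a))// (@le_trans _ _ (`|M|%:C%C * `|a|))//.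
  by rewrite ler_wpM2r// lecR ler_norm.
by rewrite -[leRHS]mulr1 ler_wpM2l// ler0c.
Qed.

Let norm_ler_normD (S T : multiplier) :
  multiplier_norm (S + T) <= multiplier_norm S + multiplier_norm T.
Proof.
exact: sup_normD (multiplier_bounded_on S) (multiplier_bounded_on T).
Qed.

Let norm_normrZ (k : R[i]) (T : multiplier) :
  multiplier_norm (k *: T) = `|k| * multiplier_norm T.
Proof. exact: sup_normZ (multiplier_bounded_on T). Qed.

Lemma multiplier_norm_ub (T : multiplier) a :
  `|T a| <= multiplier_norm T * `|a|.
Proof.
have [->|a0] := eqVneq a 0; first by rewrite multiplier0 !normr0 mulr0.
have na0 : 0 < `|a| by rewrite normr_gt0.
have nn : `|(`|a|^-1 : R[i])| = `|a|^-1 by rewrite normfV normr_id.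
rewrite -ler_pdivrMr// mulrC -{1}nn -normrZ -multiplierZ.
apply: sup_norm_ub (multiplier_bounded_on T) _.
by rewrite /unit_ball/= normrZ nn mulVf ?gt_eqF.
Qed.

Lemma multiplier_norm_le (T : multiplier) (M : R[i]) :
  0 <= M -> (forall a, `|T a| <= M * `|a|) -> multiplier_norm T <= M.
Proof.
move=> M0 TM; apply: sup_norm_le => // a a1.
by rewrite (le_trans (TM a))// -[leRHS]mulr1 ler_wpM2l.
Qed.

Let norm_eq0 (T : multiplier) : multiplier_norm T = 0 -> T = 0.
Proof.
move=> T0; apply/val_inj/funext => a /=; apply/eqP.
by rewrite -normr_le0 (le_trans (multiplier_norm_ub T a))// T0 mul0r.
Qed.

HB.instance Definition _ := Lmodule_isNormed.Build R[i] multiplier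
  norm_ler_normD norm_normrZ norm_eq0.

Lemma multiplier_norm_apply (T : multiplier) a : `|T a| <= `|T| * `|a|.
Proof. exact: multiplier_norm_ub. Qed.

Lemma multiplier_complete (F : set_system multiplier) :
  ProperFilter F -> cauchy F -> cvg F.
Proof.
move=> FF cF.
have evB (S T : multiplier) a : (S - T) a = S a - T a by [].
have cv a : cvg ((T : multiplier) a @[T --> F]).
  apply: cauchy_cvg; apply: (cauchy_ev evB FF (normr_ge0 a)) cF => T.
  by rewrite mulrC; exact: multiplier_norm_apply.
pose L a : A := lim ((T : multiplier) a @[T --> F]).
have [S SF] : exists S : multiplier, \forall T \near F, `|S - T| < 1.
  have /cauchy_ballP/(_ _ ltr01)/nearP_dep/filter_ex[S SF] := cF.
  by exists S; apply: filterS SF => T; rewrite -ball_normE.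
have SE : (complex.Re `|S| + 1)%:C%C = `|S| + 1.
  by rewrite -[in RHS]Re_normE; exact: rmorphD.
have LP : multiplier_pred L.
  apply/asboolP; split; first split.
  - move=> k a b; apply/cvg_lim => //.
    have -> : (fun T : multiplier => T (k *: a + b)) =
              (fun T : multiplier => k *: T a + T b).
      by apply/funext => T; rewrite multiplier_linear.
    by apply: cvgD; [apply: cvgZr; exact: cv|exact: cv].
  - exists (complex.Re `|S| + 1) => a.
    rewrite SE; apply: norm_cvg_le (cv a) _.
    apply: filterS SF => T /ltW ST; rewrite -[T a](subKr (S a)).
    rewrite (le_trans (ler_normB _ _))// mulrDl lerD//.
      exact: multiplier_norm_apply.
    apply: le_trans (multiplier_norm_apply (S - T) a) _.
    by rewrite ler_wpM2r.
  - move=> a b; apply/cvg_lim => //.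
    have -> : (fun T : multiplier => T (a *c b)) =
              (fun T : multiplier => a *c T b).
      by apply/funext => T; rewrite multiplierM.
    apply/cvgrPdist_lt => e e0.
    have a1 : 0 < `|a| + 1 by rewrite ltr_wpDl.
    have /cvgrPdist_lt/(_ _ (divr_gt0 e0 a1)) := cv b.
    apply: filterS => T; rewrite ltr_pdivlMr// => LT.
    rewrite -cmulBr (le_lt_trans (cnorm_mul_le _ _))//.
    by rewrite (le_lt_trans _ LT)// mulrC ler_wpM2l// lerDl.
apply/cvg_ex; exists (Multiplier LP).
apply: (cvg_ev (D := unit_ball) evB) => //.
- by move=> T M _ TM; apply: sup_norm_le.
- by move=> T a a1; apply: sup_norm_ub => //; exact: multiplier_bounded_on.
Qed.

HB.instance Definition _ := Uniform_isComplete.Build multiplier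
  multiplier_complete.

Lemma multiplierMl (T : multiplier) a b : T (a *c b) = T a *c b.
Proof. by rewrite cmulC multiplierM cmulC. Qed.

Lemma multiplier_comm (S T : multiplier) a : S (T a) = T (S a).
Proof.
apply: cmulI => c; rewrite -multiplierM multiplierMl -multiplierM -multiplierMl.
by rewrite !multiplierM.
Qed.

Lemma bounded_operatorI (T : A -> A) (M : R[i]) : linear T -> 0 <= M ->
  (forall a, `|T a| <= M * `|a|) -> is_bounded_operator T.
Proof.
move=> Tl M0 TM; split=> //; exists (complex.Re M) => a.
by rewrite RRe_real ?ger0_real.
Qed.

Let mul_le (S T : multiplier) a : `|(S \o T) a| <= `|S| * `|T| * `|a|.
Proof.
rewrite /= (le_trans (multiplier_norm_apply _ _))// -mulrA ler_wpM2l//.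
exact: multiplier_norm_apply.
Qed.

Let mul_subproof (S T : multiplier) : multiplier_pred (S \o T).
Proof.
apply/asboolP; split; last by move=> a b; rewrite /= !multiplierM.
apply: (bounded_operatorI _ _ (mul_le S T)); last by rewrite mulr_ge0.
by move=> k a b; rewrite /= !multiplier_linear.
Qed.

Definition multiplier_mul (S T : multiplier) : multiplier :=
  Multiplier (mul_subproof S T).

Let star_le (T : multiplier) a : `|(T a^star)^star| <= `|T| * `|a|.
Proof.
by rewrite cnorm_star -(cnorm_star a); exact: multiplier_norm_apply.
Qed.

Let star_subproof (T : multiplier) : multiplier_pred (fun a => (T a^star)^star).
Proof.
apply/asboolP; split; last first.
  by move=> a b; rewrite cstarM multiplierMl cstarM cstarK.
apply: (bounded_operatorI _ _ (star_le T)) => // k a b.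
by rewrite cstarD cstarZ multiplier_linear cstarD cstarZ conjCK.
Qed.

Definition multiplier_star (T : multiplier) : multiplier :=
  Multiplier (star_subproof T).

Let mulA : associative multiplier_mul.
Proof. by move=> S T U; apply/val_inj/funext. Qed.
Let mulDl : left_distributive multiplier_mul +%R.
Proof. by move=> S T U; apply/val_inj/funext. Qed.
Let mulDr : right_distributive multiplier_mul +%R.
Proof. by move=> S T U; apply/val_inj/funext => a; exact: multiplierD. Qed.
Let scaleAl (k : R[i]) (S T : multiplier) :
  k *: multiplier_mul S T = multiplier_mul (k *: S) T.
Proof. exact/val_inj/funext. Qed.
Let scaleAr (k : R[i]) (S T : multiplier) :
  k *: multiplier_mul S T = multiplier_mul S (k *: T).
Proof. by apply/val_inj/funext => a; exact/esym/multiplierZ. Qed.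
Let starK : involutive multiplier_star.
Proof. by move=> T; apply/val_inj/funext => a; rewrite /= !cstarK. Qed.
Let starD : {morph multiplier_star : S T / S + T >-> S + T}.
Proof. by move=> S T; apply/val_inj/funext => a; exact: cstarD. Qed.
Let starZ (k : R[i]) (T : multiplier) :
  multiplier_star (k *: T) = k^* *: multiplier_star T.
Proof. by apply/val_inj/funext => a; exact: cstarZ. Qed.
Let mulC : commutative multiplier_mul.
Proof. by move=> S T; apply/val_inj/funext => a; exact: multiplier_comm. Qed.
Let starM (S T : multiplier) : multiplier_star (multiplier_mul S T) =
  multiplier_mul (multiplier_star T) (multiplier_star S).
Proof. by rewrite [RHS]mulC; apply/val_inj/funext => a; rewrite /= cstarK. Qed.
Let norm_mul_le (S T : multiplier) : `|multiplier_mul S T| <= `|S| * `|T|.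
Proof.
apply: (@multiplier_norm_le (multiplier_mul S T)); last exact: mul_le.
by rewrite mulr_ge0.
Qed.
Let norm_star_mul (T : multiplier) :
  `|multiplier_mul (multiplier_star T) T| = `|T| ^+ 2.
Proof.
apply/eqP; rewrite eq_le; apply/andP; split.
  rewrite (le_trans (norm_mul_le _ _))// expr2 ler_wpM2r//.
  by apply: (@multiplier_norm_le (multiplier_star T)); last exact: star_le.
set N := `|_|; have N0 : 0 <= N by exact: normr_ge0.
rewrite -[leRHS]sqrtCK ler_sqr ?nnegrE ?sqrtC_ge0//.
apply: multiplier_norm_le; rewrite ?sqrtC_ge0// => a.
rewrite -ler_sqr ?nnegrE ?mulr_ge0 ?sqrtC_ge0// exprMn sqrtCK.
rewrite -cnorm_cstar_mul.
have -> : (T a)^star = multiplier_star T a^star by rewrite /= cstarK.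
rewrite -multiplierM cmulC multiplierM (le_trans (cnorm_mul_le _ _))//.
rewrite expr2 mulrCA ler_wpM2l// multiplier_comm -(cnorm_star a).
exact: (multiplier_norm_apply (multiplier_mul (multiplier_star T) T)).
Qed.

HB.instance Definition _ := CompleteNormedModule_isCStarAlgebra.Build R
  multiplier mulA mulDl mulDr scaleAl scaleAr starK starD starZ starM
  norm_mul_le norm_star_mul.
HB.instance Definition _ := CStarAlgebra_isAbelian.Build R multiplier mulC.

End multiplier.

Section embeddings.
Context {R : realType}.

Definition star_homomorphism (A B : cstarAlgType R) (phi : A -> B) :=
  [/\ linear phi, {morph phi : a b / a *c b} & {morph phi : a / a^star}].

Definition ell_infty_embedding (A : cstarAlgType R) (phi : A -> ell_infty R) :=
  star_homomorphism phi /\ injective phi.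

Definition ell_infty_embeddable (A : cstarAlgType R) :=
  exists phi : A -> ell_infty R, ell_infty_embedding phi.

Definition universally_ell_infty_minus_c0_embeddable (A : cstarAlgType R) :=
  (exists phi : A -> ell_infty R,
     ell_infty_embedding phi /\ range phi `&` c0 R = [set 0]) /\
  (forall phi : A -> ell_infty R,
     ell_infty_embedding phi -> range phi `&` c0 R = [set 0]).

End embeddings.

(* Main.v *)
Require Import Defs.
From mathcomp Require Import all_boot all_order all_algebra.
From mathcomp Require Import all_classical all_reals.
From mathcomp Require Import topology normedtype sequences.
From mathcomp Require Import complex.

(** Write chi_n for the [n]-th coordinate of an embedding [phi] of [A] into
    [ell_infty]: it is a character of [A], or zero. A character extends to the
    multiplier algebra by chi(T) = chi (T e) for any [e] with chi(e) = 1, and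
    the extension satisfies chi(T) chi(a) = chi (T a). Characters of a
    C*-algebra are contractive ([character_contractive], by a Neumann series),
    so the extended coordinates assemble into a map from [M(A)] to [ell_infty].
    It is injective, since T is determined by the values [phi (T a)]. Hence
    every embedding of [A] extends, along the canonical inclusion
    [left_multiplication] of [A] into [M(A)], to an embedding of [M(A)]
    ([embedding_extends]).

    For the equivalence, if the embeddings of [M(A)] avoid [c0] then so do those
    of [A], because each of them is the restriction of one of the former. In the
    other direction let [psi] embed [M(A)] and suppose that [psi T] is null.
    As [c0] is an ideal of [ell_infty], [psi] is null at T composed with the
    multiplication by any [a], which is the multiplication by [T a]; as the
    restriction of [psi] to [A] avoids [c0], [T a = 0] for all [a], so
    [T = 0]. *)

Set Implicit Arguments.
Unset Strict Implicit.
Unset Printing Implicit Defensive.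

Import Order.TTheory GRing.Theory Num.Theory.
Import numFieldNormedType.Exports.

Local Open Scope classical_set_scope.
Local Open Scope ring_scope.
Local Open Scope cstar_scope.

(** * Characters are contractive *)

Section characters.
Variables (R : realType) (B : cstarAlgType R).

Lemma expr_lt_eps (r C e : R[i]) : 0 <= r -> r < 1 -> 0 <= C -> 0 < e ->
  exists N, r ^+ N * C < e.
Proof.
move=> r0 r1 C0 e0.
have C1 : 0 < C + 1 by rewrite ltr_wpDl.
have eC0 : 0 < e / (C + 1) by rewrite divr_gt0.
have rE : (complex.Re r)%:C%C = r by rewrite RRe_real ?ger0_real.
have eE : (complex.Re (e / (C + 1)))%:C%C = e / (C + 1).
  by rewrite RRe_real ?gtr0_real.
have Rr1 : `|complex.Re r| < 1.
  by rewrite ger0_norm -?ltcR -?lecR rE.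
have Re0 : 0 < complex.Re (e / (C + 1)) by rewrite -ltcR eE.
have /cvgrPdist_lt/(_ _ Re0)/filter_ex[N] := cvg_expr Rr1.
rewrite sub0r normrN => NP; exists N.
have : r ^+ N < e / (C + 1).
  by rewrite -rE -rmorphXn -eE ltcR (le_lt_trans (ler_norm _)).
rewrite ltr_pdivlMr//; apply: le_lt_trans.
by rewrite ler_wpM2l ?exprn_ge0// lerDl.
Qed.

(** The element [c] is the sum of the Neumann series b + b^2 + b^3 + ..., that
    is, (1 - b)^-1 - 1, which lies in [B] even when [B] has no unit. *)
Lemma neumann_series (b : B) : `|b| < 1 -> exists c : B, c = b + b *c c.
Proof.
move=> b1; pose f x : B := b + b *c x; pose s n := iter n f 0.
pose C := (1 - `|b|)^-1.
have b0 : 0 < 1 - `|b| by rewrite subr_gt0.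
have C0 : 0 <= C by rewrite invr_ge0 ltW.
have f_lip x y : `|f x - f y| <= `|b| * `|x - y|.
  by rewrite /f opprD addrACA subrr add0r -cmulBr cnorm_mul_le.
have s_le m : `|s m| <= C.
  elim: m => [|m IH]; first by rewrite normr0.
  have -> : C = 1 + `|b| * C.
    by apply: (mulIf (lt0r_neq0 b0)); rewrite mulrDl -mulrA mulVf ?gt_eqF//
      mulr1 mul1r subrK.
  rewrite (le_trans (ler_normD _ _))// lerD ?(ltW b1)//.
  by rewrite (le_trans (cnorm_mul_le _ _))// ler_wpM2l.
(* The difference is b^n s_m up to sign, as f x - f y = b (x - y). *)
have s_dist n m : `|s n - s (n + m)%N| <= `|b| ^+ n * C.
  elim: n => [|n IH]; first by rewrite sub0r normrN expr0 mul1r.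
  by rewrite addSn exprS -mulrA (le_trans (f_lip _ _))// ler_wpM2l.
have s_cvg : cvg (s @ \oo).
  apply: cauchy_cvg; apply: cauchy_exP => e e0.
  have [N sN] := expr_lt_eps (normr_ge0 b) b1 C0 e0.
  exists (s N), N => // n /= Nn; rewrite -ball_normE/=.
  by rewrite -(subnKC Nn) (le_lt_trans (s_dist _ _)).
have s_shift : (fun n => s n.+1) @ \oo --> lim (s @ \oo).
  by rewrite (cvg_shiftS s).
have s_step : (fun n => s n.+1) @ \oo --> f (lim (s @ \oo)).
  apply/cvgrPdist_lt => e e0.
  have /cvgrPdist_lt/(_ _ e0) := s_cvg.
  apply: filterS => n; apply: le_lt_trans; apply: le_trans (f_lip _ _) _.
  by rewrite ler_piMl// (ltW b1).
exists (lim (s @ \oo)).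
exact: (cvg_unique (@norm_hausdorff _ B) s_shift s_step).
Qed.

(** If |chi(a)| > |a|, then b = a / chi(a) has norm less than 1 and chi(b) = 1,
    so applying chi to c = b + bc gives chi(c) = 1 + chi(c). *)
Lemma character_contractive (chi : B -> R[i]^o) : linear chi ->
    (forall a b, chi (a *c b) = chi a * chi b) ->
  forall a, `|chi a| <= `|a|.
Proof.
move=> chiL chiM a.
have chi0 : chi 0 = 0.
  by apply: (addrI (1 *: chi 0)); rewrite -chiL scale1r !addr0 scale1r.
rewrite real_leNgt ?normr_real//; apply/negP => a_lt.
have chia : chi a != 0.
  by rewrite -normr_gt0 (le_lt_trans _ a_lt).
have [|c cE] := @neumann_series ((chi a)^-1 *: a).
  by rewrite normrZ normfV mulrC ltr_pdivrMr ?mul1r ?normr_gt0.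
have chib : chi ((chi a)^-1 *: a) = 1.
  by rewrite -[_ *: _]addr0 chiL chi0 addr0 [_ *: _]mulVf.
have : chi c = 1 + chi c.
  rewrite {1}cE -[X in chi (X + _)]scale1r chiL chiM chib mul1r.
  by rewrite scale1r.
move/(congr1 (fun x => x - chi c)); rewrite subrr addrK => /esym/eqP.
by rewrite oner_eq0.
Qed.

End characters.

(** * Embeddings and null sequences *)

Section star_homomorphisms.
Variables (R : realType).

Lemma star_homomorphism0 (A B : cstarAlgType R) (phi : A -> B) :
  star_homomorphism phi -> phi 0 = 0.
Proof.
case=> phiL _ _; apply: (addrI (1 *: phi 0)).
by rewrite -phiL scale1r !addr0 scale1r.
Qed.

Lemma star_homomorphism_inj (A B : cstarAlgType R) (phi : A -> B) :
  star_homomorphism phi -> (forall a, phi a = 0 -> a = 0) -> injective phi.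
Proof.
move=> [phiL _ _] ker0 a b ab; apply/eqP; rewrite -subr_eq0; apply/eqP.
by apply: ker0; rewrite addrC -scaleN1r phiL ab scaleN1r addNr.
Qed.

Lemma star_homomorphism_comp (A B C : cstarAlgType R) (psi : B -> C)
    (phi : A -> B) : star_homomorphism psi -> star_homomorphism phi ->
  star_homomorphism (psi \o phi).
Proof.
move=> [psiL psiM psiS] [phiL phiM phiS]; split=> [k a b|a b|a] /=.
- by rewrite phiL psiL.
- by rewrite phiM psiM.
- by rewrite phiS psiS.
Qed.

Lemma c0_mulr (u v : ell_infty R) : c0 R u -> c0 R (u *c v).
Proof.
move=> /cvgrPdist_lt u0; apply/cvgrPdist_lt => e e0.
have v1 : 0 < `|v| + 1 by rewrite ltr_wpDl.
have := u0 _ (divr_gt0 e0 v1); apply: filterS => n.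
rewrite !sub0r !normrN ltr_pdivlMr// normrM; apply: le_lt_trans.
by rewrite ler_wpM2l// (le_trans (ell_infty_norm_ub v n))// lerDl.
Qed.

Lemma c0_0 : c0 R 0.
Proof. exact: (@cvg_cst R[i]^o). Qed.

(** The form in which the condition on ranges is restricted to [A] and lifted
    to [M(A)]. *)
Lemma embedding_range_c0P (A : cstarAlgType R) (phi : A -> ell_infty R) :
  ell_infty_embedding phi ->
  (range phi `&` c0 R = [set 0]) <-> (forall a, c0 R (phi a) -> a = 0).
Proof.
move=> [phiH phiI]; have phi0 := star_homomorphism0 phiH; split.
  move=> phic a ca; apply: phiI; rewrite phi0.
  by have : (range phi `&` c0 R) (phi a) by []; rewrite phic.
move=> phic; apply/seteqP; split=> [_ [[a _ <-]] /phic ->//|_ ->].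
by split; [exists 0|exact: c0_0].
Qed.

End star_homomorphisms.

(** * The multiplier algebra *)

Section multipliers.
Variables (R : realType) (A : abelianCstarAlgType R).

Lemma left_multiplication_subproof (a : A) :
  multiplier_pred (fun b => a *c b).
Proof.
apply/asboolP; split; last by move=> b c; rewrite !cmulA (cmulC a).
apply: (@bounded_operatorI _ _ _ `|a|) => // [k b c|b].
  by rewrite cmulDr cscaleAr.
exact: cnorm_mul_le.
Qed.

Definition left_multiplication (a : A) : multiplier A :=
  Multiplier (left_multiplication_subproof a).

Lemma left_multiplication_embedding :
  star_homomorphism left_multiplication /\ injective left_multiplication.
Proof.
have H : star_homomorphism left_multiplication.
  split=> [k a b|a b|a]; apply/val_inj/funext => c /=.
  - by rewrite cmulDl -cscaleAl.
  - by rewrite cmulA.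
  - by rewrite cstarM cstarK cmulC.
split=> //; apply: star_homomorphism_inj => // a /(congr1 val) a0.
by apply: cmul_eq0 => b; rewrite cmulC; exact: (congr1 (fun f => f b) a0).
Qed.

(** The image of [A] is an ideal of [M(A)]: multiplying by its elements turns
    information about a multiplier into information about elements of [A]. *)
Lemma multiplier_left_multiplication (T : multiplier A) a :
  T *c left_multiplication a = left_multiplication (T a).
Proof. by apply/val_inj/funext => b; exact: multiplierMl. Qed.

(** The condition on [e n] says chi(e) = 1 where the coordinate chi is not zero
    and is vacuous otherwise, so that vanishing coordinates need no separate
    treatment. *)
Lemma coordinate_units (phi : A -> ell_infty R) : star_homomorphism phi ->
  exists e : nat -> A, forall n a, (phi (e n) n * phi a n : R[i]) = phi a n.
Proof.
move=> phiH; have [phiL _ _] := phiH.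
suff /choice : forall n, exists e : A,
  forall a, (phi e n * phi a n : R[i]) = phi a n.
  by case=> e eP; exists e.
move=> n.
have [[a a0]|none] := pselect (exists a, phi a n != 0).
  exists ((phi a n)^-1 *: a) => b; rewrite -[_ *: a]addr0 phiL.
  rewrite (star_homomorphism0 phiH) addr0.
  by rewrite -[(_ *: _ : ell_infty R) n]/(_ * _) mulVf// mul1r.
exists 0 => a; suff -> : phi a n = 0 by rewrite mulr0.
by apply: contrapT => a0; apply: none; exists a; apply/eqP.
Qed.

(** Evaluating at [e n] before taking the [n]-th coordinate is the only possible
    extension of a nonzero coordinate; where the coordinate vanishes on [A], its
    extension is zero too. *)
Lemma embedding_extends (phi : A -> ell_infty R) : ell_infty_embedding phi ->
  exists psi : multiplier A -> ell_infty R,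
    ell_infty_embedding psi /\ forall a, psi (left_multiplication a) = phi a.
Proof.
move=> [phiH phiI]; have [phiL phiM phiS] := phiH.
have [e eP] := coordinate_units phiH.
pose chi n (T : multiplier A) : R[i]^o := phi (T (e n)) n.
have phiMn a b n : phi (a *c b) n = phi a n * phi b n by rewrite phiM.
(* Both sides equal chi_n (e_n) chi_n (T a): for e = e_n,
   (T e) a = T (e a) = e (T a). *)
have chiE n T a : chi n T * phi a n = phi (T a) n.
  by rewrite -phiMn -multiplierMl multiplierM phiMn eP.
have chiL n : linear (chi n).
  by move=> k S T; rewrite /chi -[(k *: S + T) _]/(k *: S _ + T _) phiL.
have chiM n S T : chi n (S *c T) = chi n S * chi n T by rewrite chiE.
have psi_subproof T : ell_infty_pred (fun n => chi n T).
  apply/asboolP/bounded_funE; exists (complex.Re `|T|) => n _.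
  rewrite Re_normE; exact: (character_contractive (chiL n) (chiM n)).
pose psi T := EllInfty (psi_subproof T).
have psiH : star_homomorphism psi.
  split=> [k S T|S T|T]; apply/val_inj/funext => n.
  - exact: chiL.
  - exact: chiM.
  - change (chi n (T^star) = (chi n T)^*).
    have phiSn a : phi (a^star) n = (phi a n)^* by rewrite phiS.
    by rewrite -[LHS]/(phi (T (e n)^star)^star n) phiSn -chiE phiSn rmorphM/=
      conjCK mulrC -phiSn eP phiSn.
exists psi; split=> [|a]; last first.
  by apply/val_inj/funext => n; rewrite /= /chi /= phiMn mulrC eP.
split=> //; apply: star_homomorphism_inj => // T T0.
apply/val_inj/funext => a; apply: phiI.
rewrite -[RHS]/(phi 0) (star_homomorphism0 phiH).
apply/val_inj/funext => n; rewrite /= -chiE.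
by rewrite -[chi n T]/(psi T n) T0 mul0r.
Qed.

End multipliers.

Theorem corollary2p7 (R : realType) (A : abelianCstarAlgType R) :
  ell_infty_embeddable A ->
  ell_infty_embeddable (multiplier A) /\
  (universally_ell_infty_minus_c0_embeddable (multiplier A) <->
   universally_ell_infty_minus_c0_embeddable A).
Proof.
move=> [phi0 phi0E].
have [psi0 [psi0E _]] := embedding_extends phi0E.
split; first by exists psi0.
split=> -[_ univ].
  have avoid (phi : A -> ell_infty R) :
      ell_infty_embedding phi -> range phi `&` c0 R = [set 0].
    move=> phiE; have [psi [psiE psiphi]] := embedding_extends phiE.
    apply/(embedding_range_c0P phiE) => a; rewrite -psiphi => ca.
    have [LH LI] := left_multiplication_embedding A.
    apply: LI; rewrite (star_homomorphism0 LH).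
    by apply: (proj1 (embedding_range_c0P psiE) (univ _ psiE)).
  by split=> //; exists phi0; split=> //; exact: avoid.
have avoid (psi : multiplier A -> ell_infty R) :
    ell_infty_embedding psi -> range psi `&` c0 R = [set 0].
  move=> psiE; have [psiH psiI] := psiE; have [_ psiM _] := psiH.
  have [LH LI] := left_multiplication_embedding A.
  have phiE : ell_infty_embedding (psi \o @left_multiplication R A).
    by split; [exact: star_homomorphism_comp|exact: inj_comp].
  apply/(embedding_range_c0P psiE) => T cT; apply/val_inj/funext => a.
  apply: (proj1 (embedding_range_c0P phiE) (univ _ phiE)).
  by rewrite /= -multiplier_left_multiplication psiM; exact: c0_mulr.
by split=> //; exists psi0; split=> //; exact: avoid.
Qed.
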